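(* Let $r\in\mathbb{N}$ and $\alpha\in\mathbb{R}$ be arbitrary numbers. The polynomials $$y_n(z)=y_n(r,\alpha;z):=z^n+n!\sum_{k=1}^{[n/r]}(-\alpha)^k\frac{z^{n-kr}}{(n-kr)!},\qquad n\in\mathbb{Z}_+,$$ have the following properties: (i) They satisfy the differential equation $$\alpha z\,y_n^{(r+1)}(z)+z\,y_n'(z)=n\left(\alpha y_n^{(r)}(z)+y_n(z)\right),\qquad n\in\mathbb{Z}_+.$$ (ii) They obey the mixed relation $$\alpha y_{n+1}^{(r)}(z)+y_{n+1}(z)=z\left(\alpha y_n^{(r)}(z)+y_n(z)\right),\qquad n\in\mathbb{Z}_+.$$ (iii) They are Sobolev orthogonal polynomials on the unit circle: $$\int_{\mathbb{T}}\left(y_n(z),y_n'(z),\dots,y_n^{(r)}(z)\right)M\,\overline{\begin{pmatrix}y_m(z)\\ y_m'(z)\\ \vdots\\ y_m^{(r)}(z)\end{pmatrix}}\,\frac{1}{2\pi}\,d\theta=\delta_{n,m},\qquad n,m\in\mathbb{Z}_+,$$ where $M=(1,0,\dots,0,\alpha)^T(1,0,\dots,0,\alpha)$ is an $(r+1)\times(r+1)$ matrix. (iv) If $\alpha\ne0$ and $l\in\{0,1,\dots,r-1\}$, then $$\frac{\alpha_r^{rm+l}}{(rm+l)!}\,y_{rm+l}(r,\alpha;z)\ \longrightarrow_{m\to+\infty}\ \frac1r\sum_{k=0}^{r-1}\varepsilon^{-lk}e^{\alpha_r\varepsilon^k z},\qquad \forall z\in\mathbb{C},$$ where $\varepsilon$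 is a primitive $r$-th root of unity and $\alpha_r=\left(-\frac1\alpha\right)^{1/r}$ with an arbitrary fixed value of the $r$-th root. The convergence is uniform on compact subsets of the complex plane. (v) If $\alpha\le-1$ and $m\in\mathbb{Z}_+$, then $y_{rm}(r,\alpha;z)$ has all its roots in $\{z\in\mathbb{C}:|z|\ge1\}$. If $r\ge2$, $\alpha\le-1$, $m\in\mathbb{Z}_+$ and $l\in\{1,\dots,r-1\}$, then $y_{rm+l}(r,\alpha;z)$ has a root $z=0$ of multiplicity $l$, and all its other roots lie in $\{z\in\mathbb{C}:|z|\ge1\}$.
   Context: $\mathbb{N}$: positive integers; $\mathbb{Z}_+$: non-negative integers; $[a]$ denotes the greatest integer $\le a$; $\mathbb{T}=\{z\in\mathbb{C}:|z|=1\}$. $d\theta$ is the Lebesgue measure on $[0,2\pi)$, identified with $\mathbb{T}$ by $z=e^{i\theta}$. An overline denotes (entrywise) complex conjugation and $T$ the transpose. *)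

(* Defs.v *)
From HB Require Import structures.
From mathcomp Require Import all_boot all_order all_algebra.
From mathcomp Require Import complex.
From mathcomp Require Import all_classical all_reals all_analysis.

Set Implicit Arguments.
Unset Strict Implicit.
Unset Printing Implicit Defensive.

Import Order.TTheory GRing.Theory Num.Theory.
Import numFieldNormedType.Exports.

Local Open Scope classical_set_scope.
Local Open Scope ring_scope.
Local Open Scope complex_scope.

(* The complex field is [R[i]]; its regular module [R[i]^o] is the copy that
   carries the topology and the uniformity of the modulus. *)

Definition ypoly (R : realType) (r : nat) (alpha : R) (n : nat) : {poly R[i]} :=
  'X^n + n`!%:R *:
    \sum_(1 <= k < (n %/ r).+1)
       ((- alpha)%:C ^+ k / (n - k * r)`!%:R) *: 'X^(n - k * r).

(* The series converges for every [z], so that [lim] never takes its default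
   value. *)
Definition expC (R : realType) (z : R[i]) : R[i] :=
  lim (series (fun n : nat => z ^+ n / n`!%:R : R[i]^o) @ \oo).

Definition circle_integral (R : realType) (f : R[i] -> R[i]) : R[i] :=
  let g := fun theta : R => f (expC (0 +i* theta)) in
  Rintegral lebesgue_measure `[0, 2 * pi[ (fun theta => complex.Re (g theta)) +i*
  Rintegral lebesgue_measure `[0, 2 * pi[ (fun theta => complex.Im (g theta)).

Definition jet (R : realType) (r : nat) (p : {poly R[i]}) (z : R[i]) :
    'rV[R[i]]_r.+1 :=
  \row_(j < r.+1) (p^`(j)).[z].

Definition sobolev_row (R : realType) (r : nat) (alpha : R) : 'rV[R[i]]_r.+1 :=
  \row_(j < r.+1)
    (if j == 0 :> nat then 1 else if j == r :> nat then alpha%:C else 0).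

Definition sobolev_mx (R : realType) (r : nat) (alpha : R) : 'M[R[i]]_r.+1 :=
  (sobolev_row r alpha)^T *m sobolev_row r alpha.

(* Main.v *)
Require Import Defs.
From HB Require Import structures.
From mathcomp Require Import all_boot all_order all_algebra.
From mathcomp Require Import complex zify ring.
From mathcomp Require Import all_classical all_reals all_analysis.

Set Implicit Arguments.
Unset Strict Implicit.
Unset Printing Implicit Defensive.

Import Order.TTheory GRing.Theory Num.Theory.
Import numFieldNormedType.Exports.

Local Open Scope classical_set_scope.
Local Open Scope ring_scope.
Local Open Scope complex_scope.

(** Everything rests on the identity [alpha *: y^`(r) + y = 'X^n] for
[y = y_n] ([ypoly_derivn]).  Since the [r]-th derivative of ['X^k / k!] is
['X^(k - r) / (k - r)!], or [0] when [k < r], applying [- alpha] times the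
[r]-th derivative to a summand of [y_n] yields the next summand, and the sum
telescopes to its first term.

Parts (i) and (ii) say that ['X^n] satisfies [z (z^n)' = n z^n] and
[z^(n+1) = z z^n].

For (iii), the matrix [M] has rank one, so the integrand is the product of
[alpha y_n^(r) + y_n] with the conjugate of [alpha y_m^(r) + y_m], that is
[z^n] times the conjugate of [z^m]: Sobolev orthogonality is the orthogonality
of the monomials on the circle.  It is computed through
[expC (i t) = cos t + i sin t] and the fundamental theorem of calculus.

For (iv), put [n = r m + l].  The normalisation by [a^n / n!], where
[a^r = - 1 / alpha], cancels all powers of [alpha] and leaves the sum of
[(a z)^k / k!] over the [k <= n] congruent to [l] modulo [r].  Averaging over
the [r]-th roots of unity selects these [k] from the exponential series, so the
left-hand side is exactly the right-hand side with each exponential replaced by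
a partial sum ([appell_exp_partial]).  The exponential series converges
uniformly on bounded sets ([expC_tail]), and the weights have total modulus one.

For (v), [y_(r m + l)] is [z^l] times a polynomial in [w = z^r] whose
coefficients are positive, and nonincreasing in the degree when [alpha <= -1].
By the theorem of Enestrom and Kakeya its roots satisfy [1 <= |w|].

The algebraic facts hold for any number [c] in place of [- alpha] and over any
field with a norm; they are stated for the polynomials [appell r c n]. *)

(** * The polynomials and the telescoping identity *)

(** The summand [k = 0] absorbs the isolated monomial of [ypoly], so that all
summands have one shape. These are the Appell polynomials with generating
function [exp (z t) / (1 - a t^r)]. *)
Definition appell (F : fieldType) (r : nat) (a : F) (n : nat) : {poly F} :=
  \sum_(0 <= k < (n %/ r).+1)
     (n`!%:R * a ^+ k / (n - k * r)`!%:R) *: 'X^(n - k * r).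

Lemma factr_neq0 (F : numDomainType) (n : nat) : n`!%:R != 0 :> F.
Proof. by rewrite pnatr_eq0 -lt0n fact_gt0. Qed.

Lemma ypolyE (R : realType) (r : nat) (alpha : R) (n : nat) :
  ypoly r alpha n = appell r (- alpha)%:C n.
Proof.
rewrite /appell big_ltn // mul0n subn0 expr0 mulr1 divff ?factr_neq0 //.
rewrite scale1r /ypoly scaler_sumr; congr (_ + _); apply: eq_bigr => k _.
by rewrite scalerA mulrA.
Qed.

Lemma derivn_monom (F : numFieldType) (r n : nat) : (r <= n)%N ->
  (n`!%:R^-1 *: 'X^n : {poly F})^`(r) = (n - r)`!%:R^-1 *: 'X^(n - r).
Proof.
move=> le_rn; rewrite derivnZ derivnXn -(scaler_nat _ 'X^_) scalerA.
congr (_ *: _); apply: (mulfI (factr_neq0 F n)).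
rewrite mulrA divff ?factr_neq0 // mul1r.
by rewrite -(ffact_fact le_rn) natrM mulfK // factr_neq0.
Qed.

(** The operator [a *: _^`(r)] sends the [k]-th summand to the [k.+1]-st and
kills the last one, whose degree is less than [r]. *)
Lemma appell_derivn (F : numFieldType) (r : nat) (a : F) (n : nat) :
  (0 < r)%N -> appell r a n - a *: (appell r a n)^`(r) = 'X^n.
Proof.
move=> r0; rewrite /appell.
pose u k : {poly F} :=
  (n`!%:R * a ^+ k / (n - k * r)`!%:R) *: 'X^(n - k * r).
have u0 : u 0%N = 'X^n.
  by rewrite /u mul0n subn0 expr0 mulr1 divff ?scale1r // factr_neq0.
have step k : (k < n %/ r)%N -> a *: (u k)^`(r) = u k.+1.
  move=> kn; have le : (k.+1 * r <= n)%N by rewrite -leq_divRL.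
  have le' : (r <= n - k * r)%N by move: le; rewrite mulSn; lia.
  rewrite /u -scalerA derivnZ derivn_monom // -subnDA -mulSnr !scalerA.
  by rewrite (mulrCA a) -exprS.
have top : (u (n %/ r)%N)^`(r) = 0.
  have lt : (n - n %/ r * r < r)%N.
    by rewrite [X in (X - _)%N](divn_eq n r) addKn ltn_mod.
  by rewrite /u derivnZ derivnXn (ffact_small lt) mulr0n scaler0.
have -> : a *: (\sum_(0 <= k < (n %/ r).+1) u k)^`(r)
          = \sum_(0 <= k < n %/ r) u k.+1.
  rewrite (raddf_sum (derivn r)) big_nat_recr //= top addr0 scaler_sumr.
  by apply: eq_big_nat => k; apply: step.
by rewrite big_nat_recl // -/(u 0%N) u0 addrK.
Qed.

Lemma ypoly_derivn (R : realType) (r : nat) (alpha : R) (n : nat) :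
  (0 < r)%N ->
  alpha%:C *: (ypoly r alpha n)^`(r) + ypoly r alpha n = 'X^n.
Proof.
move=> r0; rewrite ypolyE -(appell_derivn (- alpha)%:C n r0).
by rewrite rmorphN scaleNr opprK addrC.
Qed.

(** For [n = r m + l] the exponents [n - k r] are the numbers [r j + l] with
[j = m - k]. *)
Lemma appell_ascending (F : numFieldType) (r : nat) (a : F) (m l : nat) :
  (l < r)%N ->
  appell r a (r * m + l) =
  \sum_(j < m.+1)
     ((r * m + l)`!%:R * a ^+ (m - j) / (r * j + l)`!%:R) *: 'X^(r * j + l).
Proof.
move=> lr; have r0 : (0 < r)%N by apply: leq_ltn_trans lr.
rewrite /appell mulnC divnMDl // divn_small // addn0 big_mkord.
rewrite (reindex_inj rev_ord_inj) /=; apply: eq_bigr => j _.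
rewrite subSS.
have -> : (m * r + l - (m - j) * r = r * j + l)%N.
  have jm : (j <= m)%N by rewrite -ltnS.
  by rewrite mulnBl mulnC; nia.
by [].
Qed.

(** * Location of the roots *)

(** If [P w = 0], expanding [(1 - w) * P w = 0] expresses [c 0] as the sum of
[(c j - c j.+1) * w ^+ j.+1], with nonnegative differences that add up to
[c 0]. For [|w| < 1] this gives [c 0 <= |w| * c 0], which is absurd. The
convention [c m.+1 = 0] treats the leading coefficient as a difference. *)
Lemma enestrom_kakeya (F : numDomainType) (c : nat -> F) (m : nat) (w : F) :
  (forall j, (j <= m)%N -> c j.+1 <= c j) -> 0 < c 0%N -> c m.+1 = 0 ->
  \sum_(j < m.+1) c j * w ^+ j = 0 -> 1 <= `|w|.
Proof.
move=> dec c0 cm P0; rewrite real_leNgt ?real1 ?normr_real //.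
apply/negP => w1.
have key : c 0%N = \sum_(j < m.+1) (c j - c j.+1) * w ^+ j.+1.
  have S1 : \sum_(j < m.+1) c j * w ^+ j.+1 = 0.
    rewrite -[RHS](mul0r w) -[in RHS]P0 big_distrl /=.
    by apply: eq_bigr => j _; rewrite -mulrA exprSr.
  have S2 : c 0%N + \sum_(j < m.+1) c j.+1 * w ^+ j.+1 = 0.
    rewrite -[RHS]P0 [in RHS]big_ord_recl expr0 mulr1; congr (_ + _).
    by rewrite big_ord_recr /= cm mul0r addr0.
  under eq_bigr => j _ do rewrite mulrBl.
  by rewrite sumrB S1 sub0r; apply/eqP; rewrite -addr_eq0 S2.
have : c 0%N <= `|w| * c 0%N.
  rewrite -{1}(gtr0_norm c0) {1}key (le_trans (ler_norm_sum _ _ _)) //.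
  have -> : c 0%N = \sum_(0 <= j < m.+1) (c j - c j.+1).
    rewrite (telescope_sumr_eq (fun k => - c k)) ?cm ?oppr0 ?opprK ?add0r //.
    by move=> k _; rewrite opprK addrC.
  rewrite big_mkord mulr_sumr ler_sum // => j _.
  have d0 : 0 <= c j - c j.+1 by rewrite subr_ge0 dec // -ltnS.
  rewrite normrM (ger0_norm d0) mulrC ler_wpM2r // normrX exprS.
  by rewrite ler_piMr // exprn_ile1 // ltW.
by rewrite ler_pMl // (lt_geF w1).
Qed.

Definition appell_quotient (F : numFieldType) (r : nat) (a : F) (m l : nat) :
    {poly F} :=
  \sum_(j < m.+1)
     ((r * m + l)`!%:R * a ^+ (m - j) / (r * j + l)`!%:R) *: 'X^(r * j).

Lemma appell_factor (F : numFieldType) (r : nat) (a : F) (m l : nat) :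
  (l < r)%N -> appell r a (r * m + l) = appell_quotient r a m l * 'X^l.
Proof.
move=> lr; rewrite appell_ascending // /appell_quotient big_distrl /=.
by apply: eq_bigr => j _; rewrite exprD scalerAl.
Qed.

(** Divided by [(r m + l)!] the coefficients, as functions of [j], are
[a ^+ (m - j) / (r j + l)!]; with [1 <= a] numerators decrease and denominators
increase. *)
Lemma appell_quotient_root (F : numFieldType) (r : nat) (a : F) (m l : nat)
    (z : F) :
  (0 < r)%N -> 1 <= a -> root (appell_quotient r a m l) z -> 1 <= `|z|.
Proof.
move=> r0 a1 /rootP.
have a0 : 0 < a := lt_le_trans ltr01 a1.
have fpos n : 0 < n`!%:R :> F by rewrite ltr0n fact_gt0.
rewrite /appell_quotient horner_sum => P0; rewrite -(expr_ge1 r0) // -normrX.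
pose c j : F := if (j <= m)%N then a ^+ (m - j) / (r * j + l)`!%:R else 0.
have cpos j : 0 <= c j.
  by rewrite /c; case: ifP => // _; rewrite divr_ge0 ?exprn_ge0 // ltW.
apply: (@enestrom_kakeya _ c m) => [j jm||| ].
- rewrite {1}/c; case: ifP => [jm1|_]; last exact: cpos.
  rewrite /c jm ler_pM ?exprn_ge0 ?invr_ge0 ?(ltW (fpos _)) ?(ltW a0) //.
    by rewrite ler_weXn2l //; lia.
  by rewrite lef_pV2 ?posrE // ler_nat leq_fact //; nia.
- by rewrite /c leq0n divr_gt0 ?exprn_gt0.
- by rewrite /c ltnn.
apply: (mulfI (factr_neq0 F (r * m + l))); rewrite mulr0 -[RHS]P0 mulr_sumr.
apply: eq_bigr => j _; rewrite hornerZ hornerXn -exprM mulrA /c -ltnS ltn_ord.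
by rewrite mulrA.
Qed.

Lemma mup0_appell (F : numFieldType) (r : nat) (a : F) (m l : nat) :
  (l < r)%N -> 1 <= a -> mup 0 (appell r a (r * m + l)) = l.
Proof.
move=> lr a1; rewrite appell_factor // mupMr.
  by rewrite -['X]subr0 -polyC0 mup_XsubCX eqxx.
apply/negP => /(appell_quotient_root (leq_ltn_trans (leq0n l) lr) a1).
by rewrite normr0 ler10.
Qed.

Lemma appell_root_norm (F : numFieldType) (r : nat) (a : F) (m l : nat)
    (z : F) :
  (l < r)%N -> 1 <= a -> root (appell r a (r * m + l)) z -> z != 0 \/ l = 0%N ->
  1 <= `|z|.
Proof.
move=> lr a1; have r0 := leq_ltn_trans (leq0n l) lr.
rewrite appell_factor // rootM => /orP[/(appell_quotient_root r0 a1)//|].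
rewrite /root hornerXn expf_eq0 => /andP[l0 z0] [|l00].
  by rewrite z0.
by rewrite l00 in l0.
Qed.

(** * The complex exponential series *)

(** For complex [z] this is convertible to the series in the definition of
[expC]. *)
Definition exp_partial (F : numFieldType) (z : F) (N : nat) : F :=
  \sum_(0 <= n < N) z ^+ n / n`!%:R.

Lemma Re_sum (R : realType) (I : Type) (s : seq I) (F : I -> R[i]) :
  complex.Re (\sum_(i <- s) F i) = \sum_(i <- s) complex.Re (F i).
Proof. by elim/big_rec2: _ => [//|i a [b c] _ <-]; case: (F i). Qed.

Lemma Im_sum (R : realType) (I : Type) (s : seq I) (F : I -> R[i]) :
  complex.Im (\sum_(i <- s) F i) = \sum_(i <- s) complex.Im (F i).
Proof. by elim/big_rec2: _ => [//|i a [b c] _ <-]; case: (F i). Qed.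

Lemma real_complex_norm (R : realType) (x : R) : `|x%:C| = `|x|%:C.
Proof. by rewrite normc_def /= expr0n addr0 sqrtr_sqr. Qed.

Lemma normc_le_ReIm (R : realType) (z : R[i]) :
  `|z| <= (`|complex.Re z| + `|complex.Im z|)%:C.
Proof.
rewrite {1}[z]complexE rmorphD (le_trans (ler_normD _ _)) // lerD //.
  by rewrite real_complex_norm.
rewrite normrM real_complex_norm.
by rewrite normc_def /= expr0n expr1n add0r sqrtr1 mul1r.
Qed.

Lemma normc_ge_Im (R : realType) (z : R[i]) : `|complex.Im z|%:C <= `|z|.
Proof.
case: z => a b; rewrite normc_def /= lecR -sqrtr_sqr.
by rewrite ler_sqrt ?addr_ge0 ?sqr_ge0 // lerDr sqr_ge0.
Qed.

Lemma complex_pos (R : realType) (e : R[i]) :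
  0 < e -> exists2 d : R, 0 < d & e = d%:C.
Proof. by case: e => a b; rewrite ltcE /= => /andP[/eqP-> a0]; exists a. Qed.

Lemma cvg_complex (R : realType) (u : nat -> R[i]^o) (a b : R) :
  complex.Re (u n) @[n --> \oo] --> a -> complex.Im (u n) @[n --> \oo] --> b ->
  u n @[n --> \oo] --> (a +i* b : R[i]^o).
Proof.
move=> ua ub; apply/cvgrPdist_lt => _ /complex_pos[e e0 ->].
have e2 : 0 < e / 2 by rewrite divr_gt0.
move/cvgrPdist_lt/(_ _ e2) : ua => ua; move/cvgrPdist_lt/(_ _ e2) : ub => ub.
near=> n.
apply: (le_lt_trans (normc_le_ReIm _)); rewrite ltcR [e]splitr.
case E : (u n) => [x y] /=; rewrite ltrD //.
  by have : `|a - complex.Re (u n)| < e / 2; [near: n | rewrite E].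
by have : `|b - complex.Im (u n)| < e / 2; [near: n | rewrite E].
Unshelve. all: by end_near. Qed.

Lemma exp_term_norm (R : realType) (z : R[i]) (M : R) (n : nat) :
  `|z| <= M%:C -> `|z ^+ n / n`!%:R| <= (exp_coeff M n)%:C.
Proof.
move=> zM; rewrite normrM normrX normfV normr_nat /exp_coeff /=.
rewrite rmorphM rmorphXn fmorphV rmorph_nat ler_wpM2r ?invr_ge0 ?ler0n //.
by rewrite lerXn2r ?nnegrE // (le_trans _ zM).
Qed.

(** The real and imaginary parts of the series are dominated by the real
exponential series at a bound of [|z|], so that they converge absolutely. *)
Lemma expC_cvg (R : realType) (z : R[i]) :
  (exp_partial z N : R[i]^o) @[N --> \oo] --> (expC z : R[i]^o).
Proof.
suff [l ul] : exists l : R[i]^o,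
    (exp_partial z N : R[i]^o) @[N --> \oo] --> l.
  by rewrite /expC -[series _]/(exp_partial z) (cvg_lim _ ul).
have [M zM] : exists M : R, `|z| <= M%:C.
  by exists (`|complex.Re z| + `|complex.Im z|); exact: normc_le_ReIm.
have M0 : 0 <= M by rewrite -ler0c (le_trans _ zM).
have dom (f : R[i] -> R) : (forall w, `|f w|%:C <= `|w|) ->
    cvgn (series (fun n => f (z ^+ n / n`!%:R))).
  move=> fle; apply: normed_cvg.
  apply: series_le_cvg (is_cvg_series_exp_coeff M) => // n.
  - exact: normr_ge0.
  - exact: exp_coeff_ge0.
  - by rewrite -lecR (le_trans (fle _)) // exp_term_norm.
have /cvg_ex[a ca] := dom _ (@normc_ge_Re R).
have /cvg_ex[b cb] := dom _ (@normc_ge_Im R).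
exists (a +i* b); apply: cvg_complex.
  by under eq_fun => n do rewrite Re_sum.
by under eq_fun => n do rewrite Im_sum.
Qed.

(** The difference of two partial sums is at most a tail of the real series at
[M], which does not depend on [z]; the limit is approximated by a later partial
sum [N'] depending on [z]. *)
Lemma expC_tail (R : realType) (M e : R) : 0 < e ->
  exists N0, forall N (z : R[i]), (N0 <= N)%N -> `|z| <= M%:C ->
    `|expC z - exp_partial z N| < e%:C.
Proof.
move=> e0; have e2 : 0 < e / 2 by rewrite divr_gt0.
have /cvgrPdist_lt/(_ _ e2)[N0 _ N0P] := is_cvg_series_exp_coeff M.
exists N0 => N z N0N zM; have M0 : 0 <= M by rewrite -ler0c (le_trans _ zM).
have e2C : 0 < (e / 2)%:C by rewrite ltcR.
have /cvgrPdist_lt/(_ _ e2C)[N1 _ N1P] := @expC_cvg R z.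
pose N' := maxn N N1.
have tail : `|exp_partial z N' - exp_partial z N| < (e / 2)%:C.
  rewrite /exp_partial (big_cat_nat (n := N) (p := N')) ?leq_maxl //=.
  rewrite addrAC subrr add0r.
  apply: (le_lt_trans (ler_norm_sum _ _ _)).
  apply: (@le_lt_trans _ _
    (series (exp_coeff M) N' - series (exp_coeff M) N)%:C).
    rewrite sub_series_geq ?leq_maxl //.
    rewrite rmorph_sum; apply: ler_sum => n _; exact: exp_term_norm.
  rewrite ltcR; apply: (@le_lt_trans _ _ (expR M - series (exp_coeff M) N)).
    rewrite lerB //; apply: nondecreasing_cvgn_le (is_cvg_series_exp_coeff M) _.
    apply/nondecreasing_seqP => n.
    by rewrite /series /= big_nat_recr //= lerDl exp_coeff_ge0.
  exact: le_lt_trans (ler_norm _) (N0P _ N0N).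
rewrite -(subrKA (exp_partial z N')) (le_lt_trans (ler_normD _ _)) //.
rewrite [e]splitr rmorphD ltrD //.
by apply: N1P; exact: leq_maxr.
Qed.

(** * Orthogonality of the monomials on the circle *)

(** The right-hand side has the shape of the terms of the cosine and sine
series. *)
Lemma imaginary_exp (R : realType) (t : R) (n : nat) :
  (0 +i* t) ^+ n = ((~~ odd n)%:R * (-1) ^+ n./2 * t ^+ n)
                   +i* ((odd n)%:R * (-1) ^+ n.-1./2 * t ^+ n).
Proof.
have even k : (0 +i* t) ^+ k.*2 = ((-1) ^+ k * t ^+ k.*2)%:C.
  have sq : (0 +i* t) ^+ 2 = (- t ^+ 2)%:C.
    rewrite !expr2; apply/eqP.
    by rewrite eq_complex /= !(mul0r, mulr0) sub0r addr0 !eqxx.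
  by rewrite -mul2n exprM sq -rmorphXn (exprNn (t ^+ 2)) -exprM.
rewrite -(odd_double_half n); case: (odd n); rewrite ?add0n ?add1n.
  rewrite exprS even /= odd_double /= doubleK; apply/eqP; rewrite eq_complex /=.
  rewrite exprS !(mul0r, mulr0, mul1r, sub0r, oppr0, add0r, addr0).
  by rewrite mulrCA !eqxx.
by rewrite even /= odd_double /= doubleK mul1r !mul0r.
Qed.

Lemma expC_imaginary (R : realType) (t : R) :
  expC (0 +i* t) = cos t +i* sin t.
Proof.
apply: (cvg_unique (@norm_hausdorff _ R[i]^o) (@expC_cvg R (0 +i* t))).
have termE k : (0 +i* t) ^+ k / k`!%:R = cos_coeff t k +i* sin_coeff t k.
  rewrite imaginary_exp -[k`!%:R](rmorph_nat (real_complex R)) -fmorphV.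
  apply/eqP; rewrite eq_complex /= !mulr0 subr0 add0r.
  by rewrite /cos_coeff /sin_coeff /= !eqxx.
apply: cvg_complex.
  under eq_fun => n do rewrite Re_sum.
  have -> : cos t = lim (series (cos_coeff t) @ \oo) by rewrite unlock.
  rewrite (_ : (fun _ => _) = series (cos_coeff t)).
    exact: is_cvg_series_cos_coeff.
  by apply/funext => n; apply: eq_bigr => k _; rewrite termE.
under eq_fun => n do rewrite Im_sum.
have -> : sin t = lim (series (sin_coeff t) @ \oo) by rewrite unlock.
rewrite (_ : (fun _ => _) = series (sin_coeff t)).
  exact: is_cvg_series_sin_coeff.
by apply/funext => n; apply: eq_bigr => k _; rewrite termE.
Qed.

Lemma de_moivre (R : realType) (t : R) (n : nat) :
  (cos t +i* sin t) ^+ n = cos (n%:R * t) +i* sin (n%:R * t).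
Proof.
elim: n => [|n IH]; first by rewrite expr0 mul0r cos0 sin0.
rewrite exprS IH mulrSr mulrDl mul1r addrC cosD sinD.
by apply/eqP; rewrite eq_complex /= eqxx addrC eqxx.
Qed.

Lemma Rintegral_full_turn (R : realType) (f F : R -> R) :
  continuous f -> (forall x : R, is_derive x (1 : R) F (f x)) ->
  Rintegral lebesgue_measure `[0, 2 * pi[ f = F (2 * pi) - F 0.
Proof.
move=> cf dF; have pi2 : 0 < 2 * pi :> R by rewrite mulr_gt0 // pi_gt0.
have cF : continuous F.
  by move=> x; apply/differentiable_continuous/derivable1_diffP; case: (dF x).
have cfw : {within `[0, 2 * pi], continuous f} by exact: continuous_subspaceT.
have int_f : lebesgue_measure.-integrable `[0 : R, 2 * pi] (EFin \o f).
  by apply: continuous_compact_integrable => //; exact: segment_compact.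
rewrite Rintegral_itv_bndo_bndc; last first.
  apply: (integrableS _ _ _ int_f) => //.
  by apply: subset_itvl; rewrite bnd_simp.
rewrite /Rintegral (continuous_FTC2 (F := F)) //.
  split=> [x _||]; first by case: (dF x).
    by apply: cvg_at_right_filter; exact: cF.
  by apply: cvg_at_left_filter; exact: cF.
by move=> x _; rewrite derive1E derive_val.
Qed.

Lemma is_derive_scale (R : realType) (d x : R) : is_derive x (1 : R) ( *%R d) d.
Proof.
rewrite (_ : *%R d = d \*: @idfun R) //.
by apply: is_derive_eq; rewrite /GRing.scale /= mulr1.
Qed.

Lemma continuous_scale_arg (R : realType) (g : R -> R) (d w : R) :
  continuous g -> continuous (fun x => w * g (d * x)).
Proof.
move=> cg x; apply: cvgMr; apply: (@continuous_comp _ _ _ ( *%R d) g).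
  exact: mulrl_continuous.
exact: cg.
Qed.

(** On the circle the integrand is [cos (d t) + i sin (d t)], divided by
[2 pi], with [d = n - m]. For [d != 0] its antiderivatives take the same value
at [0] and [2 pi]; for [d = 0] the integrand is constant. *)
Lemma circle_integral_monom (R : realType) (n m : nat) (h : R[i] -> R[i]) :
  (forall z, h z = z ^+ n * conjc (z ^+ m) * ((2 * pi)^-1)%:C) ->
  circle_integral h = (n == m)%:R.
Proof.
move=> hE; pose d : R := n%:R - m%:R; pose w : R := (2 * pi)^-1.
have hcis t : h (expC (0 +i* t)) = w * cos (d * t) +i* (w * sin (d * t)).
  rewrite hE expC_imaginary !de_moivre /d mulrBl cosB sinB.
  apply/eqP; rewrite eq_complex /= -/w.
  by apply/andP; split; apply/eqP; ring.
have pi0 : 2 * pi != 0 :> R by rewrite mulf_neq0 ?pnatr_eq0 // gt_eqF ?pi_gt0.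
have turn k : sin (k%:R * (2 * pi)) = 0 :> R /\ cos (k%:R * (2 * pi)) = 1 :> R.
  rewrite !mulr_natl -[_ *+ k]add0r (periodicn (@sinD2pi R)).
  by rewrite (periodicn (@cosD2pi R)) sin0 cos0.
have [sin_d cos_d] : sin (d * (2 * pi)) = 0 /\ cos (d * (2 * pi)) = 1.
  rewrite /d mulrBl sinB cosB; have [-> ->] := turn n; have [-> ->] := turn m.
  by split; ring.
rewrite /circle_integral.
under [X in X +i* _]eq_Rintegral => t _ do rewrite hcis /=.
under [X in _ +i* X]eq_Rintegral => t _ do rewrite hcis /=.
have csin : continuous (@sin R) by exact: continuous_sin.
have ccos : continuous (@cos R) by exact: continuous_cos.
have [nm|nm] := eqVneq n m.
  rewrite /d nm subrr.
  under [X in X +i* _]eq_Rintegral => t _ do rewrite mul0r cos0 mulr1.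
  under [X in _ +i* X]eq_Rintegral => t _ do rewrite mul0r sin0 mulr0.
  have ccst k : continuous (cst k : R -> R) by move=> x; exact: cst_continuous.
  rewrite (Rintegral_full_turn (ccst w) (is_derive_scale w)).
  rewrite (Rintegral_full_turn (ccst 0) (fun x => is_derive_cst (0 : R) x 1)).
  by rewrite /w mulVf // mulr0 !subrr subr0.
have d0 : d != 0 by rewrite subr_eq0 eqr_nat.
have cscale g := @continuous_scale_arg R g d w.
have dcos (x : R) :
    is_derive x (1 : R) (fun x => w / d * sin (d * x)) (w * cos (d * x)).
  have -> : w * cos (d * x) = (w / d) *: (cos (d * x) * d).
    by rewrite /GRing.scale /=; field.
  by apply: is_deriveZ; apply: is_derive1_comp; exact: is_derive_scale.
have dsin (x : R) :
    is_derive x (1 : R) (fun x => - (w / d) * cos (d * x)) (w * sin (d * x)).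
  have -> : w * sin (d * x) = (- (w / d)) *: (- sin (d * x) * d).
    by rewrite /GRing.scale /=; field.
  by apply: is_deriveZ; apply: is_derive1_comp; exact: is_derive_scale.
rewrite (Rintegral_full_turn (cscale _ ccos) dcos).
rewrite (Rintegral_full_turn (cscale _ csin) dsin).
by rewrite sin_d cos_d !mulr0 sin0 cos0 !mulr0 !subrr.
Qed.

(** The Sobolev matrix is [v^T *m v] for a real row vector [v] supported in
columns [0] and [r], which are distinct because [0 < r]. *)
Lemma sobolev_form (R : realType) (r : nat) (alpha : R) (p q : {poly R[i]})
    (z : R[i]) :
  (0 < r)%N ->
  (jet r p z *m sobolev_mx r alpha *m map_mx (@conjc R) (jet r q z)^T) 0 0 =
  (alpha%:C * (p^`(r)).[z] + p.[z]) * conjc (alpha%:C * (q^`(r)).[z] + q.[z]).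
Proof.
move=> r0; pose v := @sobolev_row R r alpha.
have vsum (x : 'I_r.+1 -> R[i]) :
    \sum_j x j * v 0 j = alpha%:C * x ord_max + x ord0.
  rewrite (bigD1 ord_max) //= (bigD1 ord0) /=; last first.
    by rewrite -val_eqE /= ltn_eqF.
  rewrite big1 ?addr0 => [|j /andP[jr j0]].
    by rewrite !mxE /= eqxx gtn_eqF // mulrC mulr1.
  rewrite !mxE (negPf (j0 : j != 0%N :> nat)).
  by rewrite (negPf (jr : j != r :> nat)) mulr0.
have jetv s : (jet r s z *m v^T) 0 0 = alpha%:C * (s^`(r)).[z] + s.[z].
  rewrite mxE (eq_bigr (fun j => jet r s z 0 j * v 0 j)) => [|j _]; last first.
    by rewrite !mxE.
  by rewrite vsum !mxE.
rewrite /sobolev_mx -/v mulmxA -mulmxA mxE big_ord1 jetv; congr (_ * _).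
have -> : v = map_mx (@conjc R) v.
  apply/rowP => j; rewrite !mxE; case: ifP => _; first by rewrite conjc1.
  by case: ifP => _; rewrite ?conjc0 ?conjc_real.
have tr : v *m (jet r q z)^T = (jet r q z *m v^T)^T by rewrite trmx_mul trmxK.
by rewrite -map_mxM tr !mxE -jetv mxE.
Qed.

(** * The limit along a residue class *)

(** The summands are the powers of [eps ^+ n / eps ^+ l], an [r]-th root of
unity that equals [1] exactly when [n] is congruent to [l]; otherwise the
geometric sum vanishes. *)
Lemma root_of_unity_filter (F : fieldType) (r : nat) (eps : F) (l n : nat) :
  r.-primitive_root eps -> (l < r)%N ->
  \sum_(k < r) eps ^- (l * k) * eps ^+ (k * n)
    = if (n %% r)%N == l then r%:R else 0.
Proof.
move=> prim lr; have r0 : (0 < r)%N by apply: leq_ltn_trans lr.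
have eps0 : eps != 0.
  apply/eqP => e0; move: (prim_expr_order prim).
  by rewrite e0 expr0n gtn_eqF // => /esym/eqP; rewrite oner_eq0.
set x := eps ^+ n / eps ^+ l.
have -> : \sum_(k < r) eps ^- (l * k) * eps ^+ (k * n) = \sum_(k < r) x ^+ k.
  apply: eq_bigr => k _; rewrite /x exprMn exprVn -!exprM mulrC.
  by rewrite (mulnC n).
have <- : (x == 1) = ((n %% r)%N == l).
  rewrite /x -subr_eq0 -(divff (expf_neq0 l eps0)) -mulrBl mulf_eq0 invr_eq0.
  rewrite (negPf (expf_neq0 l eps0)) orbF subr_eq0 (eq_prim_root_expr prim).
  by rewrite (modn_small lr).
case: eqP => [->|/eqP x1].
  rewrite (eq_bigr (fun=> 1)) ?sumr_const ?card_ord // => k _.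
  by rewrite expr1n.
apply: (mulfI (_ : x - 1 != 0)); first by rewrite subr_eq0.
rewrite mulr0 -subrX1 /x exprMn exprVn -!exprM !(mulnC _ r) !exprM.
by rewrite (prim_expr_order prim) !expr1n divr1 subrr.
Qed.

Lemma sum_residue_class (V : nmodType) (G : nat -> V) (r l m : nat) :
  (l < r)%N ->
  \sum_(0 <= n < r * m) (if (n %% r)%N == l then G n else 0)
    = \sum_(j < m) G (r * j + l)%N.
Proof.
move=> lr; elim: m => [|m IH]; first by rewrite muln0 big_geq // big_ord0.
rewrite big_ord_recr /= -IH mulnS (big_cat_nat (n := (r * m)%N)) ?leq_addl //=.
congr (_ + _).
rewrite -[X in \sum_(X <= _ < _) _]add0n big_addn addnK big_mkord.
rewrite (bigD1 (Ordinal lr)) //= addnC mulnC modnMDl modn_small // eqxx.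
rewrite big1 ?addr0 // => i il.
by rewrite addnC modnMDl modn_small // (negPf (il : i != l :> nat)).
Qed.

(** Both sides are the sum of [(a z)^k / k!] over the [k < r (m + 1)] congruent
to [l] modulo [r]: on the left because [a ^+ r = c^-1] cancels the powers of
[c], on the right by the filter. *)
Lemma appell_exp_partial (F : numFieldType) (r : nat) (c a eps : F) (m l : nat)
    (z : F) :
  c != 0 -> (l < r)%N -> r.-primitive_root eps -> a ^+ r = c^-1 ->
  a ^+ (r * m + l) / (r * m + l)`!%:R * (appell r c (r * m + l)).[z] =
  r%:R^-1 * \sum_(k < r) eps ^- (l * k)
                         * exp_partial (a * eps ^+ k * z) (r * m.+1).
Proof.
move=> c0 lr prim ar; have r0 : (0 < r)%N by apply: leq_ltn_trans lr.
pose G n : F := (a * z) ^+ n / n`!%:R.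
transitivity (\sum_(j < m.+1) G (r * j + l)%N).
  rewrite appell_ascending // horner_sum mulr_sumr; apply: eq_bigr => j _.
  have jm : (j <= m)%N by rewrite -ltnS.
  have -> : a ^+ (r * m + l) = c ^- (m - j) * a ^+ (r * j + l).
    by rewrite -exprVn -ar -exprM -exprD addnA -mulnDr subnK.
  rewrite hornerZ hornerXn /G exprMn.
  have f0 := factr_neq0 F (r * m + l); have cj := expf_neq0 (m - j) c0.
  by field; rewrite f0 cj factr_neq0.
rewrite -(sum_residue_class _ _ lr).
under [in RHS]eq_bigr => k _ do rewrite /exp_partial mulr_sumr.
rewrite exchange_big mulr_sumr /=; apply: eq_bigr => n _.
rewrite (eq_bigr (fun k : 'I_r => G n * (eps ^- (l * k) * eps ^+ (k * n)))).
  rewrite -mulr_sumr root_of_unity_filter //; case: ifP => _.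
    by rewrite mulrCA mulVf ?mulr1 // pnatr_eq0 -lt0n.
  by rewrite !mulr0.
move=> k _; rewrite /G !exprMn -exprM; set u := eps ^- _; set v := eps ^+ _.
by rewrite -!mulrA; rewrite [RHS]mulrC; ring.
Qed.

Lemma prim_root_norm (F : numFieldType) (r : nat) (eps : F) :
  (0 < r)%N -> r.-primitive_root eps -> `|eps| = 1.
Proof.
move=> r0 prim; apply/eqP; rewrite -(@pexpr_eq1 _ _ r) //.
by rewrite -normrX (prim_expr_order prim) normr1.
Qed.

Definition exp_section (R : realType) (r l : nat) (eps a z : R[i]) : R[i] :=
  r%:R^-1 * \sum_(k < r) eps ^- (l * k) * expC (a * eps ^+ k * z).

(** Each of the [r] weights has modulus [r^-1], since [|eps| = 1], so an error
below [e] in every exponential gives an error below [e] in the average. *)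
Lemma appell_cvg_bounded (R : realType) (r l : nat) (c a eps : R[i]) (M e : R) :
  c != 0 -> (l < r)%N -> r.-primitive_root eps -> a ^+ r = c^-1 -> 0 < e ->
  exists m0, forall m (z : R[i]), (m0 <= m)%N -> `|z| <= M%:C ->
    `|exp_section r l eps a z
      - a ^+ (r * m + l) / (r * m + l)`!%:R * (appell r c (r * m + l)).[z]|
    < e%:C.
Proof.
move=> c0 lr prim ar e0; have r0 : (0 < r)%N by apply: leq_ltn_trans lr.
have eps1 := prim_root_norm r0 prim.
have [N0 N0P] := expC_tail (Normc.normc a * M) e0.
exists N0 => m z N0m zM.
rewrite (appell_exp_partial m z c0 lr prim ar) /exp_section -mulrBr -sumrB.
rewrite normrM normfV normr_nat ltr_pdivrMl ?ltr0n //.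
apply: (le_lt_trans (ler_norm_sum _ _ _)).
have -> : r%:R * e%:C = \sum_(k < r) e%:C.
  by rewrite sumr_const card_ord mulr_natl.
apply: ltr_sum.
  by apply/hasP; exists (Ordinal lr); rewrite ?mem_index_enum.
move=> k _; rewrite -mulrBr normrM normfV normrX eps1 expr1n invr1 mul1r.
apply: N0P.
  by rewrite (leq_trans N0m) // (leq_trans (leqnSn m)) // leq_pmull.
rewrite !normrM normrX eps1 expr1n mulr1 rmorphM ler_wpM2l //.
Qed.

(** The modulus is a continuous real-valued function, so a compact set has a
bounded image under it. *)
Lemma compact_complex_bounded (R : realType) (K : set R[i]^o) :
  compact K -> exists M : R, forall z : R[i], K z -> `|z| <= M%:C.
Proof.
move=> cK; pose h (z : R[i]^o) : R := Normc.normc (z : R[i]).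
have ch : continuous h.
  move=> z; apply/(cvgrPdist_lt (FF := nbhs_filter z)) => e e0.
  have e0C : 0 < e%:C by rewrite ltcR.
  have /(cvgrPdist_lt (FF := nbhs_filter z))/(_ _ e0C) near_z :=
    @cvg_id _ (nbhs z).
  apply: filterS near_z => w zw; rewrite -ltcR (le_lt_trans _ zw) //.
  rewrite -real_complex_norm rmorphB; exact: (@ler_dist_dist _ R[i]).
have /compact_bounded[M [_ MP]] : compact (h @` K).
  by apply: continuous_compact cK; exact: continuous_subspaceT.
exists (M + 1) => z Kz; rewrite -[`|z|]/((h z)%:C) lecR.
by rewrite (le_trans (ler_norm _)) // (MP (M + 1)) ?ltrDl //; exists z.
Qed.

Lemma appell_cvg (R : realType) (r l : nat) (c a eps : R[i]) :
  c != 0 -> (l < r)%N -> r.-primitive_root eps -> a ^+ r = c^-1 ->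
  let f := fun (m : nat) (z : R[i]^o) =>
    (a ^+ (r * m + l) / (r * m + l)`!%:R * (appell r c (r * m + l)).[z]
       : R[i]^o) in
  let g := fun z : R[i]^o => (exp_section r l eps a z : R[i]^o) in
  (forall z : R[i]^o, f m z @[m --> \oo] --> g z) /\
  (forall K : set R[i]^o, compact K -> {uniform K, f @ \oo --> g}).
Proof.
move=> c0 lr prim ar f g; split=> [z|K /compact_complex_bounded[M KM]].
  apply/cvgrPdist_lt => _ /complex_pos[e e0 ->].
  have [m0 m0P] := appell_cvg_bounded (Normc.normc z) c0 lr prim ar e0.
  by exists m0 => // m m0m; apply: m0P.
move=> P /uniform_nbhs[E [entE EP]].
move: entE; rewrite -entourage_ballE => -[_ /= /complex_pos[e e0 ->] eE].
have [m0 m0P] := appell_cvg_bounded M c0 lr prim ar e0.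
exists m0 => // m m0m; apply: EP => z Kz; apply: eE => /=.
by rewrite -ball_normE /=; apply: m0P => //; exact: KM.
Qed.

(** * The theorem *)

Theorem theorem1 (R : realType) (r : nat) (alpha : R) (hr : (0 < r)%N) :
  let y := ypoly r alpha in
  [/\ (* (i) *)
      forall (n : nat) (z : R[i]),
        alpha%:C * z * ((y n)^`(r.+1)).[z] + z * ((y n)^`()).[z]
        = n%:R * (alpha%:C * ((y n)^`(r)).[z] + (y n).[z]),
      (* (ii) *)
      forall (n : nat) (z : R[i]),
        alpha%:C * ((y n.+1)^`(r)).[z] + (y n.+1).[z]
        = z * (alpha%:C * ((y n)^`(r)).[z] + (y n).[z]),
      (* (iii) *)
      forall n m : nat,
        circle_integral (fun z : R[i] =>
          (jet r (y n) z *m sobolev_mx r alpha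
             *m map_mx (@conjc R) (jet r (y m) z)^T) 0 0
          * ((2 * pi)^-1)%:C)
        = (n == m)%:R,
      (* (iv) *)
      alpha != 0 ->
      forall (l : nat) (eps alphar : R[i]), (l < r)%N ->
        r.-primitive_root eps ->
        alphar ^+ r = (- alpha^-1)%:C ->
        let f := fun (m : nat) (z : R[i]^o) =>
          (alphar ^+ (r * m + l) / (r * m + l)`!%:R * (y (r * m + l)%N).[z]
             : R[i]^o) in
        let g := fun z : R[i]^o =>
          (r%:R^-1 *
             \sum_(k < r) eps ^- (l * k) * expC (alphar * eps ^+ k * z)
             : R[i]^o) in
        (forall z : R[i]^o, f m z @[m --> \oo] --> g z) /\
        (forall K : set R[i]^o, compact K -> {uniform K, f @ \oo --> g})
    & (* (v) *)
      alpha <= -1 ->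
      (forall (m : nat) (z : R[i]), root (y (r * m)%N) z -> 1 <= `|z|) /\
      ((2 <= r)%N -> forall m l : nat, (0 < l < r)%N ->
         mup 0 (y (r * m + l)%N) = l /\
         (forall z : R[i], root (y (r * m + l)%N) z -> z != 0 -> 1 <= `|z|))].
Proof.
move=> y; have yE n := @ypoly_derivn R r alpha n hr.
have yz n z : alpha%:C * ((y n)^`(r)).[z] + (y n).[z] = z ^+ n.
  by rewrite -hornerZ -hornerD yE hornerXn.
split.
- move=> n z; rewrite yz.
  (* Both sides of the differential equation are [z * ('X^n)^`().[z]]. *)
  have <- : (('X^n : {poly R[i]})^`()).[z] * z = n%:R * z ^+ n.
    case: n => [|n]; first by rewrite expr0 derivC horner0 !mul0r.
    by rewrite derivXn hornerMn hornerXn mulrnAl -exprSr mulr_natl.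
  have <- : alpha%:C *: (y n)^`(r.+1) + (y n)^`() = ('X^n)^`().
    by rewrite -yE derivnS [RHS]derivD derivZ.
  by rewrite hornerD hornerZ mulrDl (mulrC z) mulrAC.
- by move=> n z; rewrite !yz exprS.
- move=> n m; apply: circle_integral_monom => z.
  by rewrite sobolev_form // !yz.
- move=> alpha0 l eps a lr prim ar.
  have c0 : (- alpha)%:C != 0 by rewrite fmorph_eq0 oppr_eq0.
  have arc : a ^+ r = ((- alpha)%:C)^-1 by rewrite ar -invrN fmorphV.
  have yfun : y = appell r (- alpha)%:C by apply/funext => n; rewrite /y ypolyE.
  by rewrite yfun; exact: appell_cvg.
- move=> alpha1; have a1 : 1 <= (- alpha)%:C :> R[i] by rewrite lecR lerNr.
  split=> [m z|r2 m l /andP[l0 lr]].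
    rewrite /y ypolyE -[(r * m)%N]addn0 => rz.
    by apply: (appell_root_norm hr a1 rz); right.
  split; first by rewrite /y ypolyE; exact: mup0_appell.
  move=> z; rewrite /y ypolyE => rz z0.
  by apply: (appell_root_norm lr a1 rz); left.
Qed.
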